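(* For the min-max binary prediction problem with two binary sequences under adversarial input, the min-max static regret of any online algorithm is $\Omega(T)$: there is a constant $c>0$ such that for every online algorithm $\mathcal A$ and all sufficiently large $T$, $$R^b_{\mathcal A}(T)=\max_{b_t^1,b_t^2}\{C^b_{\mathcal A}-C^b_{\mathsf{OPT}}\}\ge cT,$$ where the maximum is over the binary sequences $(b_t^1)_{t=1}^T,(b_t^2)_{t=1}^T$.
   Context: At each time $t=1,\dots,T$ the online algorithm $\mathcal A$ chooses (predicts) an action $x_t\in\{0,1\}$, after which the bits $b_t^1,b_t^2\in\{0,1\}$ are revealed. The costs are $$C^b_{\mathcal A}=\max\Big\{\sum_{t=1}^T\mathbf 1\{x_t\ne b_t^1\},\ \sum_{t=1}^T\mathbf 1\{x_t\ne b_t^2\}\Big\},\qquad C^b_{\mathsf{OPT}}=\min_{x\in\{0,1\}}\max\Big\{\sum_{t=1}^T\mathbf 1\{x\ne b_t^1\},\ \sum_{t=1}^T\mathbf 1\{x\ne b_t^2\}\Big\}.$$ *)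

(* Defs.v *)
From HB Require Import structures.
From mathcomp Require Import all_boot all_order all_algebra.
From mathcomp Require Import reals.

Set Implicit Arguments.
Unset Strict Implicit.
Unset Printing Implicit Defensive.

Import Order.TTheory GRing.Theory Num.Theory.
Local Open Scope ring_scope.

(* Bits and actions are booleans (true = 1). *)

Definition mistakes (T : nat) (x b : T.-tuple bool) : nat :=
  (\sum_(t < T) (tnth x t != tnth b t))%N.

Definition minmax_cost (T : nat) (x b1 b2 : T.-tuple bool) : nat :=
  maxn (mistakes x b1) (mistakes x b2).

Definition opt_cost (T : nat) (b1 b2 : T.-tuple bool) : nat :=
  minn (minmax_cost (nseq_tuple T false) b1 b2)
       (minmax_cost (nseq_tuple T true) b1 b2).

(* [A T h] is the action played when the horizon is T and h lists the pairs
   (b_s^1, b_s^2) revealed so far, oldest first; the algorithm may thus be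
   tuned to the horizon. *)
Definition online_alg := nat -> seq (bool * bool) -> bool.

Definition actions (A : online_alg) (T : nat) (b1 b2 : T.-tuple bool) :
    T.-tuple bool :=
  [tuple A T (take t (zip b1 b2)) | t < T].

Definition alg_cost (A : online_alg) (T : nat) (b1 b2 : T.-tuple bool) : nat :=
  minmax_cost (actions A b1 b2) b1 b2.

(* [predict1 A T h x] is the conditional probability of playing 1 given the
   horizon T, the revealed pairs h and the algorithm's own past actions x. *)
Record rand_online_alg (R : realType) := RandOnlineAlg {
  predict1 :> nat -> seq (bool * bool) -> seq bool -> R;
  predict1_itv : forall T h x, 0 <= predict1 T h x <= 1
}.

(* The probability that A plays exactly x_1, ..., x_T on input (b1, b2). *)
Definition actions_prob (R : realType) (A : rand_online_alg R) (T : nat)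
    (b1 b2 x : T.-tuple bool) : R :=
  \prod_(t < T)
    let p := predict1 A T (take t (zip b1 b2)) (take t x) in
    if tnth x t then p else 1 - p.

Definition expected_cost (R : realType) (A : rand_online_alg R) (T : nat)
    (b1 b2 : T.-tuple bool) : R :=
  \sum_(x : T.-tuple bool) actions_prob A b1 b2 x * (minmax_cost x b1 b2)%:R.

(* The base value of the big max is itself one of the values of F, so this is
   the maximum of F even where F is negative. *)
Definition max_input (R : realType) (T : nat)
    (F : T.-tuple bool -> T.-tuple bool -> R) : R :=
  \big[Num.max/F (nseq_tuple T false) (nseq_tuple T false)]_(b :
    T.-tuple bool * T.-tuple bool) F b.1 b.2.

Definition regret (R : realType) (A : online_alg) (T : nat) : R :=
  max_input (fun b1 b2 : T.-tuple bool =>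
    (alg_cost A b1 b2)%:R - (opt_cost b1 b2)%:R).

(* The input is fixed before the algorithm's coins are tossed (oblivious
   adversary). *)
Definition expected_regret (R : realType) (A : rand_online_alg R) (T : nat) : R :=
  max_input (fun b1 b2 : T.-tuple bool =>
    expected_cost A b1 b2 - (opt_cost b1 b2)%:R).

(* Main.v *)
(** By Yao's principle it suffices to exhibit random inputs with linear average
    regret. Let n be about T/3, and play (0, 1) for the first n rounds. Then
    either (i) the first sequence becomes fair coin flips and the second one
    stays at 0, or (ii) the first one stays at 1 and the second one becomes fair
    coin flips. The two scenarios cannot be distinguished during the first n
    rounds, where the errors on the first sequence in (i) and on the second one
    in (ii) sum to n; afterwards any algorithm errs on half of the coin flips.
    So the costs in (i) and (ii) sum to at least n + 2n on average, whereas the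
    constant action 0 in (i), resp. 1 in (ii), costs only n + O(sqrt n).
    Deterministic algorithms are randomized ones with Dirac predictions. *)

Require Import Defs.
From HB Require Import structures.
From mathcomp Require Import all_boot all_order all_algebra.
From mathcomp Require Import reals.
From mathcomp Require Import zify ring lra.

Import Order.TTheory GRing.Theory Num.Theory.
Local Open Scope ring_scope.

Set Implicit Arguments.
Unset Strict Implicit.
Unset Printing Implicit Defensive.

(** * Flipping one bit of a tuple *)

Definition flip (T : nat) (t : 'I_T) (x : T.-tuple bool) : T.-tuple bool :=
  [tuple (s == t) (+) tnth x s | s < T].

Lemma tnth_flip (T : nat) (t s : 'I_T) (x : T.-tuple bool) :
  tnth (flip t x) s = (s == t) (+) tnth x s.
Proof. by rewrite tnth_mktuple. Qed.

Lemma flipK (T : nat) (t : 'I_T) : involutive (@flip T t).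
Proof. by move=> x; apply: eq_from_tnth => s; rewrite !tnth_flip addKb. Qed.

Lemma eq_take_tuple (T : nat) (U : Type) (x y : T.-tuple U) (k : nat) :
  (forall s : 'I_T, (s < k)%N -> tnth x s = tnth y s) -> take k x = take k y.
Proof.
case: T x y => [|T] x y xy; first by rewrite (tuple0 x) (tuple0 y).
have u0 := tnth x ord0.
apply: (@eq_from_nth _ u0) => [|i]; first by rewrite !size_take !size_tuple.
rewrite size_take_min size_tuple leq_min => /andP[lt_ik lt_iT].
rewrite !nth_take //.
have := xy (Ordinal lt_iT) lt_ik.
by rewrite !(tnth_nth u0).
Qed.

Lemma take_zip (U V : Type) (s : seq U) (u : seq V) (k : nat) :
  take k (zip s u) = zip (take k s) (take k u).
Proof. by elim: s u k => [|a s IHs] [|b u] [|k] //=; rewrite ?IHs //; case: take. Qed.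

(** Since [flip t] is a bijection, summing [G] counts every [F x] twice. *)
Lemma sum_flip_half (R : realType) (T : nat) (t : 'I_T)
    (F G : T.-tuple bool -> R) :
  (forall x, F x + F (flip t x) = G x) -> \sum_x F x = 2^-1 * \sum_x G x.
Proof.
move=> FG.
have -> : \sum_x G x = \sum_x F x + \sum_x F x.
  rewrite [X in _ = _ + X](reindex_inj (inv_inj (@flipK T t))) -big_split /=.
  by apply: eq_bigr => x _; rewrite FG.
lra.
Qed.

(** * Marginal laws of the actions of a randomized algorithm *)

Section Marginals.
Variables (R : realType) (A : rand_online_alg R) (T : nat).
Implicit Types (b x : T.-tuple bool) (t : 'I_T).

Definition step_prob b1 b2 x t : R :=
  let p := predict1 A T (take t (zip b1 b2)) (take t x) in
  if tnth x t then p else 1 - p.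

(** The probability that the first [k] actions are those of [x], kept as a function of the whole
    tuple so that all sums range over one type. *)
Definition prefix_prob b1 b2 (k : nat) x : R :=
  \prod_(t < T | (t < k)%N) step_prob b1 b2 x t.

Lemma actions_prob_prefix b1 b2 x : actions_prob A b1 b2 x = prefix_prob b1 b2 T x.
Proof. by apply: eq_bigl => t; rewrite ltn_ord. Qed.

Lemma step_prob_flip b1 b2 x t :
  step_prob b1 b2 x t + step_prob b1 b2 (flip t x) t = 1.
Proof.
rewrite /step_prob tnth_flip eqxx.
have -> : take t (flip t x) = take t x.
  apply: eq_take_tuple => s lt_st; rewrite tnth_flip.
  by case: eqP lt_st => // ->; rewrite ltnn.
by case: (tnth x t) => /=; rewrite ?subrK // addrC subrK.
Qed.

Lemma prefix_prob_flip b1 b2 x t (k : nat) : (k <= t)%N ->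
  prefix_prob b1 b2 k (flip t x) = prefix_prob b1 b2 k x.
Proof.
move=> le_kt; apply: eq_bigr => s lt_sk; rewrite /step_prob.
have lt_st : (s < t)%N by exact: leq_trans lt_sk le_kt.
rewrite tnth_flip.
have -> : take s (flip t x) = take s x.
  apply: eq_take_tuple => u lt_us; rewrite tnth_flip.
  by case: eqP lt_us => // ->; rewrite ltnNge (ltnW lt_st).
by case: eqP lt_st => // ->; rewrite ltnn.
Qed.

Lemma prefix_probS b1 b2 x t :
  prefix_prob b1 b2 t.+1 x = step_prob b1 b2 x t * prefix_prob b1 b2 t x.
Proof.
rewrite /prefix_prob (bigD1 t) ?ltnSn //=; congr (_ * _).
by apply: eq_bigl => s; rewrite ltnS ltn_neqAle andbC.
Qed.

(* Flipping the last action averages out its factor, so the actions on which [f]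
   does not depend can be summed out one at a time. *)
Lemma sum_prefix_prob b1 b2 (k : nat) (f : T.-tuple bool -> R) : (k <= T)%N ->
  (forall t x, (k <= t)%N -> f (flip t x) = f x) ->
  \sum_x actions_prob A b1 b2 x * f x =
  2^-1 ^+ (T - k) * \sum_x prefix_prob b1 b2 k x * f x.
Proof.
move=> + f_flip; under eq_bigr do rewrite actions_prob_prefix.
suff main j : (j + k <= T)%N ->
    \sum_x prefix_prob b1 b2 (j + k) x * f x =
    2^-1 ^+ j * \sum_x prefix_prob b1 b2 k x * f x.
  by move=> le_kT; rewrite -main subnK.
elim: j => [|j IHj] lt_jT; first by rewrite mul1r.
rewrite exprS -mulrA -IHj; last exact: ltnW.
pose t := Ordinal lt_jT.
apply: (@sum_flip_half R T t) => x.
rewrite -[(j.+1 + k)%N]/(t.+1) !prefix_probS f_flip ?leq_addl //.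
rewrite prefix_prob_flip // -mulrDl -mulrDl step_prob_flip mul1r.
by [].
Qed.

Lemma sum_tuple1 : \sum_(x : T.-tuple bool) (1 : R) = 2 ^+ T.
Proof. by rewrite sumr_const card_tuple card_bool natrX. Qed.

Lemma sum_actions_prob b1 b2 : \sum_x actions_prob A b1 b2 x = 1.
Proof.
(* A constant function depends on no action, so all [T] actions sum out. *)
under eq_bigr do rewrite -[actions_prob _ _ _ _]mulr1.
rewrite (@sum_prefix_prob b1 b2 0) // subn0.
under eq_bigr do rewrite mulr1 /prefix_prob big_pred0 //.
by rewrite sum_tuple1 -exprMn mulVf ?expr1n ?pnatr_eq0.
Qed.

Lemma actions_prob_ge0 b1 b2 x : 0 <= actions_prob A b1 b2 x.
Proof.
apply: prodr_ge0 => t _ /=.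
have /andP[p0 p1] := predict1_itv A T (take t (zip b1 b2)) (take t x).
by case: ifP => _; rewrite ?subr_ge0.
Qed.

Definition marginal b1 b2 t : R :=
  \sum_x actions_prob A b1 b2 x * (tnth x t)%:R.

(** Actions after round [t] sum out, and the factors that remain only read pairs revealed before
    round [t]. *)
Lemma marginal_causal b1 b2 c1 c2 t :
  (forall s : 'I_T, (s < t)%N -> tnth b1 s = tnth c1 s /\ tnth b2 s = tnth c2 s) ->
  marginal b1 b2 t = marginal c1 c2 t.
Proof.
move=> bc; rewrite /marginal !(@sum_prefix_prob _ _ t.+1) //; last first.
- by move=> s x; rewrite tnth_flip; case: eqP => [->|//]; rewrite ltnn.
- by move=> s x; rewrite tnth_flip; case: eqP => [->|//]; rewrite ltnn.
congr (_ * _); apply: eq_bigr => x _; congr (_ * _).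
apply: eq_bigr => s; rewrite ltnS => le_st; rewrite /step_prob !take_zip.
have -> : take s b1 = take s c1.
  by apply: eq_take_tuple => u lt_us; case: (bc u) => //; exact: leq_trans le_st.
have -> // : take s b2 = take s c2.
by apply: eq_take_tuple => u lt_us; case: (bc u) => //; exact: leq_trans le_st.
Qed.

Definition error_prob b1 b2 b t : R :=
  if tnth b t then 1 - marginal b1 b2 t else marginal b1 b2 t.

Lemma expected_mistakes b1 b2 b :
  \sum_x actions_prob A b1 b2 x * (mistakes x b)%:R =
  \sum_t error_prob b1 b2 b t.
Proof.
under eq_bigr do rewrite natr_sum mulr_sumr.
rewrite exchange_big; apply: eq_bigr => t _ /=; rewrite /error_prob.
case: (tnth b t).
  rewrite -[X in X - _](sum_actions_prob b1 b2) -sumrB; apply: eq_bigr => x _.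
  by case: (tnth x t); rewrite /= ?mulr1 ?mulr0 ?subrr ?subr0.
by apply: eq_bigr => x _; case: (tnth x t).
Qed.

Lemma expected_cost_ge1 b1 b2 : \sum_t error_prob b1 b2 b1 t <= expected_cost A b1 b2.
Proof.
rewrite -expected_mistakes; apply: ler_sum => x _.
apply: ler_wpM2l; first exact: actions_prob_ge0.
by rewrite ler_nat leq_maxl.
Qed.

Lemma expected_cost_ge2 b1 b2 : \sum_t error_prob b1 b2 b2 t <= expected_cost A b1 b2.
Proof.
rewrite -expected_mistakes; apply: ler_sum => x _.
apply: ler_wpM2l; first exact: actions_prob_ge0.
by rewrite ler_nat leq_maxr.
Qed.

End Marginals.

(** * The two random scenarios and the errors they force *)

Section HardInputs.
Variables (R : realType) (T n : nat).
Hypothesis le_nT : (n <= T)%N.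
Implicit Types r : T.-tuple bool.

(* [(early0 r, early)] is the input of scenario (i) and [(late, early1 r)] that
   of scenario (ii), where only the coins [tnth r t] with [n <= t] are used. *)
Definition late : T.-tuple bool := [tuple (n <= t)%N | t < T].
Definition early : T.-tuple bool := [tuple (t < n)%N | t < T].
Definition early0 r : T.-tuple bool := [tuple (n <= t)%N && tnth r t | t < T].
Definition early1 r : T.-tuple bool := [tuple (t < n)%N || tnth r t | t < T].

(** Each round contributes 1 on average over [r]: an early one because the two scenarios look alike
    and ask for opposite bits, a late one because each scenario errs on a fresh coin with
    probability 1/2. *)
Lemma sum_errors (A : rand_online_alg R) :
  \sum_r (\sum_t error_prob A (early0 r) early (early0 r) t +
          \sum_t error_prob A late (early1 r) (early1 r) t) = T%:R * 2 ^+ T.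
Proof.
under eq_bigr do rewrite -big_split /=.
have -> : T%:R = \sum_(t < T) 1 :> R by rewrite sumr_const card_ord.
rewrite exchange_big mulr_suml /=.
apply: eq_bigr => t _; rewrite mul1r -(sum_tuple1 R T).
case: (ltnP t n) => [lt_tn|le_nt].
  apply: eq_bigr => r _; rewrite /error_prob !tnth_mktuple lt_tn leqNgt lt_tn /=.
  rewrite (@marginal_causal _ _ _ _ _ late (early1 r)) ?subrKC // => s lt_st.
  have lt_sn := ltn_trans lt_st lt_tn.
  by rewrite !tnth_mktuple leqNgt lt_sn.
(* Pair [r] with [flip t r]: the action of round [t] has the same law for both, so in each scenario
   the two error probabilities sum to 1. *)
have -> : \sum_(x : T.-tuple bool) (1 : R) = 2^-1 * \sum_(x : T.-tuple bool) 2.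
  by rewrite mulr_sumr; apply: eq_bigr => x _; rewrite mulVf ?pnatr_eq0.
apply: (@sum_flip_half R T t) => r; rewrite /error_prob !tnth_mktuple eqxx.
rewrite le_nt ltnNge le_nt /=.
have flipE (s : 'I_T) : (s < t)%N -> tnth (flip t r) s = tnth r s.
  by rewrite tnth_flip; case: eqP => [->|//]; rewrite ltnn.
rewrite (@marginal_causal _ _ _ (early0 (flip t r)) _ (early0 r) early); last first.
  by move=> s lt_st; rewrite !tnth_mktuple -tnth_flip flipE.
rewrite (@marginal_causal _ _ _ late (early1 (flip t r)) late (early1 r)); last first.
  by move=> s lt_st; rewrite !tnth_mktuple -tnth_flip flipE.
by case: (tnth r t) => /=; ring.
Qed.

(** * Second moment of the sum of the late coins *)

Definition spin r (t : 'I_T) : R := if tnth r t then 1 else -1.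
Definition magnetization r : R := \sum_(t < T | (n <= t)%N) spin r t.

Lemma sum_late : (\sum_(t < T | n <= t) 1 = T - n)%N.
Proof.
rewrite -(big_mkord (leq n) (fun=> 1%N)).
by rewrite -(@big_nat_widenl _ _ _ n 0 T predT) // sum_nat_const_nat muln1.
Qed.

Lemma sum_magnetization_sqr :
  \sum_r magnetization r ^+ 2 = (T - n)%:R * 2 ^+ T.
Proof.
have cross (t s : 'I_T) : \sum_r spin r t * spin r s = (s == t)%:R * 2 ^+ T.
  have [->|ne_st] := eqVneq s t.
    rewrite mul1r -(sum_tuple1 R T); apply: eq_bigr => r _.
    by rewrite /spin; case: ifP; rewrite ?mulr1 ?mulrNN ?mulr1.
  (* Flipping coin [t] changes the sign of exactly one of the two factors. *)
  rewrite mul0r (@sum_flip_half R T t _ (fun=> 0)) ?big1 ?mulr0 // => r.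
  rewrite /spin !tnth_flip eqxx (negPf ne_st) /=.
  by do 2 case: (tnth r _) => /=; ring.
under eq_bigr do rewrite expr2 mulr_suml.
rewrite exchange_big /=.
under eq_bigr => t le_nt.
  under eq_bigr do rewrite mulr_sumr.
  rewrite exchange_big /=.
  under eq_bigr do rewrite cross.
  rewrite (bigD1 t) //= eqxx mul1r big1 ?addr0; last first.
    by move=> s /andP[_ /negPf->]; rewrite mul0r.
  over.
rewrite -[LHS]mul1r mulr_sumr -mulr_suml; congr (_ * _).
by rewrite -sum_late natr_sum.
Qed.

(** * Costs of the constant actions *)

Lemma mistakes_false_early0 r :
  (mistakes (nseq_tuple T false) (early0 r))%:R =
  ((T - n)%:R + magnetization r) / 2 :> R.
Proof.
rewrite /mistakes /magnetization -sum_late !natr_sum -big_split mulr_suml /=.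
rewrite [RHS]big_mkcond; apply: eq_bigr => t _ /=.
rewrite !tnth_mktuple (tnth_nth false) nth_nseq if_same /spin.
by case: (leqP n t) => _; case: (tnth r t) => //=; lra.
Qed.

Lemma mistakes_true_early1 r :
  (mistakes (nseq_tuple T true) (early1 r))%:R =
  ((T - n)%:R - magnetization r) / 2 :> R.
Proof.
rewrite /mistakes /magnetization -sum_late !natr_sum -sumrB mulr_suml /=.
rewrite [RHS]big_mkcond; apply: eq_bigr => t _ /=.
rewrite !tnth_mktuple (tnth_nth true) nth_nseq if_same /spin.
by case: (leqP n t) => _; case: (tnth r t) => //=; lra.
Qed.

Lemma sum_early : (\sum_(t < T) (t < n) = n)%N.
Proof. by rewrite -big_mkcond /= -(big_ord_widen _ (fun=> 1%N)) // sum1_card card_ord. Qed.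

Lemma mistakes_false_early : mistakes (nseq_tuple T false) early = n.
Proof.
rewrite -[RHS]sum_early; apply: eq_bigr => t _.
by rewrite tnth_mktuple (tnth_nth false) nth_nseq if_same; case: (t < n)%N.
Qed.

Lemma mistakes_true_late : mistakes (nseq_tuple T true) late = n.
Proof.
rewrite -[RHS]sum_early; apply: eq_bigr => t _.
by rewrite tnth_mktuple (tnth_nth true) nth_nseq if_same ltnNge; case: (n <= t)%N.
Qed.

(* AM-GM replaces the deviation of the magnetization by its square, whose mean
   is known exactly. *)
Lemma half_deviation_le (d s : R) : 0 < d -> s / 2 <= d + s ^+ 2 / (16 * d).
Proof.
move=> d0; have : 0 <= (s / 4 - d) ^+ 2 / d by rewrite divr_ge0 ?sqr_ge0 // ltW.
have -> : (s / 4 - d) ^+ 2 / d = d + s ^+ 2 / (16 * d) - s / 2.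
  by field; rewrite gt_eqF.
by rewrite subr_ge0.
Qed.

(** Action 0 in (i) and action 1 in (ii) see the magnetization with opposite signs; a bound in its
    square serves both. *)
Lemma sum_opt_le r (d : R) : (T <= 3 * n + 2)%N -> 0 < d ->
  (opt_cost (early0 r) early)%:R + (opt_cost late (early1 r))%:R <=
  2 * (n%:R + 1 + d) + magnetization r ^+ 2 / (8 * d).
Proof.
move=> leT d0.
(* Half of this is [n + 1], whence the extra 1 in the bound. *)
have lem : (T - n)%:R <= 2 * n%:R + 2 :> R by rewrite -natrM -natrD ler_nat; lia.
have sq0 : 0 <= magnetization r ^+ 2 / (16 * d).
  by rewrite divr_ge0 ?sqr_ge0 // mulr_ge0 // ltW.
have bnd (k a : nat) : (k <= maxn a n)%N ->
    a%:R <= n%:R + 1 + d + magnetization r ^+ 2 / (16 * d) ->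
    k%:R <= n%:R + 1 + d + magnetization r ^+ 2 / (16 * d).
  rewrite leq_max => /orP[le_k|le_k] le_a; rewrite -(ler_nat R) in le_k.
    exact: le_trans le_k le_a.
  lra.
have -> : magnetization r ^+ 2 / (8 * d) = 2 * (magnetization r ^+ 2 / (16 * d)).
  by field; rewrite gt_eqF.
rewrite -mulrDr mulr_natl mulr2n; apply: lerD.
  apply: (@bnd _ (mistakes (nseq_tuple T false) (early0 r))).
    by rewrite /opt_cost geq_min /minmax_cost mistakes_false_early leqnn.
  rewrite mistakes_false_early0.
  have := half_deviation_le (magnetization r) d0; lra.
apply: (@bnd _ (mistakes (nseq_tuple T true) (early1 r))).
  rewrite geq_min; apply/orP; right.
  by rewrite /minmax_cost mistakes_true_late maxnC leqnn.
rewrite mistakes_true_early1.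
have := half_deviation_le (- magnetization r) d0; rewrite sqrrN; lra.
Qed.

End HardInputs.

(** * From average regret to maximal regret *)

Lemma max_input_ge (R : realType) (T : nat) (F : T.-tuple bool -> T.-tuple bool -> R)
    (b1 b2 : T.-tuple bool) : F b1 b2 <= max_input F.
Proof. exact: (le_bigmax _ (fun b => F b.1 b.2) (b1, b2)). Qed.

Lemma expected_regret_ge (R : realType) (A : rand_online_alg R) (T n : nat) (d : R) :
  (n <= T <= 3 * n + 2)%N -> 0 < d ->
  T%:R - 2 * (n%:R + 1 + d) - (T - n)%:R / (8 * d) <= 2 * expected_regret A T.
Proof.
move=> /andP[le_nT leT] d0.
have P0 : 0 < 2 ^+ T :> R by rewrite exprn_gt0.
rewrite -(ler_pM2r P0).
have -> : 2 * expected_regret A T * 2 ^+ T =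
    \sum_(r : T.-tuple bool) 2 * expected_regret A T.
  by rewrite -(sum_tuple1 R T) mulr_sumr; apply: eq_bigr => r _; rewrite mulr1.
have -> : (T%:R - 2 * (n%:R + 1 + d) - (T - n)%:R / (8 * d)) * 2 ^+ T =
  \sum_(r : T.-tuple bool)
    ((\sum_t error_prob A (early0 n r) (early T n) (early0 n r) t +
      \sum_t error_prob A (late T n) (early1 n r) (early1 n r) t) -
     (2 * (n%:R + 1 + d) * 1 + magnetization R n r ^+ 2 / (8 * d))).
  rewrite sumrB sum_errors // big_split /= -mulr_sumr -mulr_suml.
  by rewrite sum_tuple1 sum_magnetization_sqr; ring.
apply: ler_sum => r _; rewrite mulr1.
have := sum_opt_le le_nT r leT d0.
have := expected_cost_ge1 A (early0 n r) (early T n).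
have := expected_cost_ge2 A (late T n) (early1 n r).
have := max_input_ge (fun b1 b2 => expected_cost A b1 b2 - (opt_cost b1 b2)%:R)
  (early0 n r) (early T n).
have := max_input_ge (fun b1 b2 => expected_cost A b1 b2 - (opt_cost b1 b2)%:R)
  (late T n) (early1 n r).
rewrite /expected_regret; lra.
Qed.

Lemma expected_regret_linear (R : realType) (A : rand_online_alg R) (T : nat) :
  (60 <= T)%N -> 24^-1 * T%:R <= expected_regret A T.
Proof.
move=> T60; pose n := (T %/ 3)%N.
have [n20 nT leT] : [/\ (20 <= n)%N, (3 * n <= T)%N & (T <= 3 * n + 2)%N].
  by rewrite /n; split; lia.
(* With [d = n / 4] the second-moment term is at most 2, so twice the regret is at least
   [T - 5n/2 - 4], hence at least [T/6 - 4]; this exceeds [T/12] once [T] is at least 48. *)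
have n0 : 0 < n%:R / 4 :> R by rewrite divr_gt0 // ltr0n; lia.
have range : (n <= T <= 3 * n + 2)%N by rewrite leT andbT; lia.
have := expected_regret_ge A range n0.
have : (T - n)%:R / (8 * (n%:R / 4)) <= 2 :> R.
  rewrite ler_pdivrMr; last by lra.
  have -> : 2 * (8 * (n%:R / 4)) = (4 * n)%:R :> R by rewrite natrM; field.
  by rewrite ler_nat; lia.
have : 3 * n%:R <= T%:R :> R by rewrite -natrM ler_nat.
have : T%:R <= 3 * n%:R + 2 :> R by rewrite -natrM -natrD ler_nat.
have : 60 <= T%:R :> R by rewrite ler_nat.
lra.
Qed.

(** * Deterministic algorithms as Dirac randomized ones *)

Section Derandomized.
Variables (R : realType) (A : online_alg).

Definition dirac_predict (T : nat) (h : seq (bool * bool)) (x : seq bool) : R :=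
  (A T h)%:R.

Lemma dirac_predict_itv T h x : 0 <= dirac_predict T h x <= 1.
Proof. by rewrite ler0n lern1 leq_b1. Qed.

Definition dirac_alg : rand_online_alg R := RandOnlineAlg dirac_predict_itv.

Lemma expected_cost_dirac (T : nat) (b1 b2 : T.-tuple bool) :
  expected_cost dirac_alg b1 b2 = (alg_cost A b1 b2)%:R.
Proof.
rewrite /expected_cost (bigD1 (actions A b1 b2)) //= [X in _ + X]big1 ?addr0.
  rewrite /actions_prob big1 ?mul1r // => t _.
  by rewrite tnth_mktuple /= /dirac_predict; case: (A _ _); rewrite ?subr0.
move=> x ne_x; have [t ne_t] : exists t, tnth x t != tnth (actions A b1 b2) t.
  apply/existsP; apply: contraR ne_x => /existsPn eq_x.
  by apply/eqP/eq_from_tnth => t; apply/eqP; have := eq_x t; rewrite negbK.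
(* The factor of a round where [x] departs from the actions of [A] is 0. *)
rewrite /actions_prob (bigD1 t) //= /dirac_predict; move: ne_t.
rewrite tnth_mktuple.
by case: (tnth x t); case: (A _ _) => //= _; rewrite ?subrr !mul0r.
Qed.

Lemma expected_regret_dirac (T : nat) : expected_regret dirac_alg T = regret R A T.
Proof.
(* This rewrites the base value of the big max; its terms come next. *)
rewrite /expected_regret /regret /max_input expected_cost_dirac.
by apply: eq_bigr => b _; rewrite expected_cost_dirac.
Qed.

End Derandomized.

Theorem theorem10 (R : realType) :
  exists2 c : R, 0 < c &
    (forall A : online_alg, exists T0 : nat, forall T : nat,
       (T0 <= T)%N -> c * T%:R <= regret R A T) /\
    (forall A : rand_online_alg R, exists T0 : nat, forall T : nat,
       (T0 <= T)%N -> c * T%:R <= expected_regret A T).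
Proof.
exists 24^-1; first by rewrite invr_gt0.
split=> A; exists 60%N => T T60; last exact: expected_regret_linear.
by rewrite -expected_regret_dirac; apply: expected_regret_linear.
Qed.
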